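(* Let $F$ be a noncyclic finitely generated free group. Then there exist an infinite set $S$ and an action of $F$ on $S$ such that: (1) the action is highly transitive; and (2) for every finitely generated subgroup $L$ of infinite index in $F$, the restriction of the action to $L$ is locally finite. Furthermore, every action of $F$ on an infinite set with properties (1) and (2) is faithful.
   Context: An action of a group on a set is faithful if its kernel is trivial. It is highly transitive if it is $k$-transitive for every integer $k\ge 1$, i.e. for every $k\geq 1$ and any two $k$-tuples $(s_1,\dots,s_k)$, $(s'_1,\dots,s'_k)$ of pairwise distinct points there is a group element sending $s_j$ to $s'_j$ for all $j=1,\dots,k$. An action is called locally finite if all of its orbits are finite. *)

(* Defs.v *)
From mathcomp Require Import all_boot all_classical.

Set Implicit Arguments.
Unset Strict Implicit.
Unset Printing Implicit Defensive.

Local Open Scope classical_set_scope.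
Local Open Scope group_scope.

Section Groups.
Variable G : groupType.
Implicit Types (A L X : set G).

Definition is_subgroup L : Prop :=
  [/\ L 1,
      forall x y : G, L x -> L y -> L (x * y)
    & forall x : G, L x -> L x^-1].

Definition generated A : set G := smallest is_subgroup A.

Definition finitely_generated L : Prop :=
  exists2 A : set G, finite_set A & L = generated A.

Definition is_cyclic L : Prop := exists g : G, L = generated [set g].

Definition left_coset (x : G) L : set G := [set x * l | l in L].

Definition infinite_index L : Prop :=
  infinite_set [set left_coset x L | x in [set: G]].

(* The letter (x, false) stands for x and the letter (x, true) for x^-1. *)
Definition word_over X (w : seq (G * bool)) : Prop :=
  forall l : G * bool, l \in w -> X l.1.

Definition reduced (w : seq (G * bool)) : bool :=
  sorted (fun l m => ~~ ((l.1 == m.1) && (l.2 != m.2))) w.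

Definition word_value (w : seq (G * bool)) : G :=
  \prod_(l <- w) (if l.2 then l.1^-1 else l.1).

Definition free_basis X : Prop :=
  forall g : G, exists! w : seq (G * bool),
    [/\ word_over X w, reduced w & word_value w = g].

End Groups.

Definition free_group (G : groupType) : Prop := exists X : set G, free_basis X.

Record group_action (G : groupType) (S : Type) := GroupAction {
  act :> G -> S -> S;
  act1 : forall s : S, act 1 s = s;
  actM : forall (g h : G) (s : S), act (g * h) s = act g (act h s)
}.

Section Actions.
Variables (G : groupType) (S : Type) (a : group_action G S).

Definition action_kernel : set G := [set g | forall s : S, a g s = s].

Definition faithful_action : Prop := action_kernel = [set 1].

Definition k_transitive (k : nat) : Prop :=
  forall s s' : 'I_k -> S, injective s -> injective s' ->
    exists g : G, forall j : 'I_k, a g (s j) = s' j.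

Definition highly_transitive : Prop :=
  forall k : nat, (1 <= k)%N -> k_transitive k.

Definition orbit_under (L : set G) (s : S) : set S := [set a g s | g in L].

Definition locally_finite_on (L : set G) : Prop :=
  forall s : S, finite_set (orbit_under L s).

End Actions.

(* Main.v *)
(* Existence.  The Schreier graph of the action is built on nat as a limit of finite
   transitive actions, each carrying one distinguished edge; passing to the next
   action may change this edge only, so every other edge is final.
   - High transitivity: cutting the distinguished edge and hanging a tree of positive
     words on it, one finds a word w carrying all the points of the finite action to
     distinct leaves of the tree; a further letter may then permute these leaves
     arbitrarily, and its conjugate by w realizes any permutation of the points.
   - Local finiteness: a finitely generated subgroup L of infinite index fixes a point
     of a finite action with a set D such that the generators of L, read from that
     point, stay in D, and some word w takes D off itself.  The distinguished edge is
     spliced into a finite set of maps D -> W; paths read by elements of L only visit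
     maps whose image meets D, so they miss the map w, where the next distinguished
     edge is placed.  Hence the L-orbits of all earlier points are finite and final.

   Faithfulness.  A shortest nontrivial word with value in the kernel N labels a
   cycle, which extends to a finite action.  The loops avoiding one edge of the cycle
   form a finitely generated subgroup M of infinite index (count the signed crossings
   of the edge), while modulo N this edge is redundant, so that finitely many cosets of
   M, together with N, cover F.  Local finiteness of M then makes the whole orbit
   finite. *)

Require Import Defs.
From mathcomp Require Import all_boot perm all_classical ssralg ssrint zify.

Set Implicit Arguments.
Unset Strict Implicit.
Unset Printing Implicit Defensive.

(** * Words acting through letters *)

Section WordActions.
Variable K : eqType.
Implicit Types (l : K * bool) (w : seq (K * bool)) (p : seq K).

Definition linv l := (l.1, ~~ l.2).
Definition winv w := rev (map linv w).
Definition pos p : seq (K * bool) := [seq (y, false) | y <- p].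

Lemma linvK : involutive linv.
Proof. by case=> x e; rewrite /linv negbK. Qed.

Lemma winv_cons l w : winv (l :: w) = rcons (winv w) (linv l).
Proof. by rewrite /winv /= rev_cons. Qed.

Section OneAction.
Variables (T : Type) (m : K * bool -> T -> T).

(** Applied to both signs of a letter, this makes [m] an action of the free group on [K], given by
    its generators alone. *)
Definition letter_action := forall l v, m (linv l) (m l v) = v.

(** The rightmost letter acts first, as in a left action. *)
Definition wact w v := foldr m v w.

(* The oriented edge [l0] leaving [t], traversed in either direction. *)
Definition crosses t l0 l v :=
  (l = l0 /\ v = t) \/ (l = linv l0 /\ v = m l0 t).

Fixpoint avoids t l0 w u : Prop :=
  if w is l :: w' then avoids t l0 w' u /\ ~ crosses t l0 l (wact w' u)
  else True.

Lemma wact_cat w1 w2 v : wact (w1 ++ w2) v = wact w1 (wact w2 v).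
Proof. exact: foldr_cat. Qed.

Lemma avoids_cat t l0 w1 w2 u :
  avoids t l0 (w1 ++ w2) u <-> avoids t l0 w2 u /\ avoids t l0 w1 (wact w2 u).
Proof.
elim: w1 => [|l w1 IH] /=; first by split=> [|[]].
by rewrite wact_cat IH; tauto.
Qed.

Hypothesis mP : letter_action.

Lemma letter_actionV l v : m l (m (linv l) v) = v.
Proof. by rewrite -{1}(linvK l) mP. Qed.

Lemma letter_action_inj l : injective (m l).
Proof. exact: can_inj (mP l). Qed.

Lemma wactV w v : wact (winv w) (wact w v) = v.
Proof.
by elim: w => //= l w IH; rewrite winv_cons -cats1 wact_cat /= mP.
Qed.

Lemma crossesV t l0 l v : crosses t l0 (linv l) (m l v) -> crosses t l0 l v.
Proof.
case=> [[<- <-]|[/(can_inj linvK)-> /letter_action_inj ->]]; last by left.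
by right; rewrite linvK mP.
Qed.

Lemma avoidsV t l0 w u : avoids t l0 w u -> avoids t l0 (winv w) (wact w u).
Proof.
elim: w => //= l w IH [hw hl]; rewrite winv_cons -cats1; apply/avoids_cat.
split=> /=; last by rewrite mP; apply: IH.
by split=> // /crossesV.
Qed.

End OneAction.

(** * Transferring paths between actions that differ at one edge *)

Section Transfer.
Variables (T T' : Type) (m : K * bool -> T -> T) (m' : K * bool -> T' -> T').
Variables (P : T -> Prop) (j : T -> T') (t : T) (z : K).
Hypotheses (mP : letter_action m) (m'P : letter_action m').
Hypothesis stableP : forall l v, P v -> P (m l v).
Hypothesis agree : forall y v, P v -> ~ (y = z /\ v = t) ->
  m' (y, false) (j v) = j (m (y, false) v).

(** [agree] concerns positive letters; for a negative letter it is applied to the edge ending at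
    [v], whose source again satisfies [P]. *)
Lemma transfer_letter l v : P v -> ~ crosses m t (z, false) l v ->
  m' l (j v) = j (m l v).
Proof.
case: l => y [] Pv nc; last first.
  by apply: agree => // -[yz vt]; apply: nc; left; rewrite yz.
pose u := m (y, true) v; have uE : m (y, false) u = v by exact: mP (y, true) v.
rewrite -/u -[in LHS]uE -agree ?(m'P (y, false)) //; first exact: stableP.
by move=> [yz ut]; apply: nc; right; rewrite -ut -uE yz.
Qed.

Lemma wact_stable w v : P v -> P (wact m w v).
Proof. by move=> Pv; elim: w => //= l w; apply: stableP. Qed.

Lemma transfer_word w v : P v -> avoids m t (z, false) w v ->
  wact m' w (j v) = j (wact m w v).
Proof.
move=> Pv; elim: w => //= l w IH [aw nc].
by rewrite IH // transfer_letter //; apply: wact_stable.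
Qed.

End Transfer.
End WordActions.

(** * Completing partial actions on finite sets *)

Section Completion.

Lemma partial_injection_extends (T : finType) (h : T -> option T) :
  (forall u v c, h u = Some c -> h v = Some c -> u = v) ->
  exists s : {perm T}, forall u c, h u = Some c -> s u = c.
Proof.
have [n] := ubnP #|[pred u | h u == None]|; elim: n h => // n IH h hn hinj.
case: (pickP [pred u | h u == None]) => [u0 /= /eqP hu0|hT]; last first.
  pose f u := odflt u (h u).
  have hf u : h u = Some (f u) by have := hT u; rewrite /f /=; case: (h u).
  have finj : injective f by move=> u v fuv; apply: (hinj u v (f u)); rewrite hf // fuv.
  by exists (perm finj) => u c; rewrite permE hf => -[].
(* If every value were taken, a choice of preimages would be injective, hence onto, and [h] would be
   defined at [u0]. *)
have [c0 hc0] : exists c0, forall u, h u <> Some c0.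
  apply: contrapT => /forallNP H.
  have {H} /choice [g hg] : forall c, exists u, h u = Some c.
    by move=> c; have /existsNP[u /contrapT hu] := H c; exists u.
  have ginj : injective g by move=> c d gcd; have := hg c; rewrite gcd hg => -[].
  have /codomP[c u0E] := injF_onto ginj u0.
  by move: hu0; rewrite u0E hg.
pose h' u := if u == u0 then Some c0 else h u.
case: (IH h').
- rewrite -ltnS; apply: leq_trans hn; rewrite ltnS; apply: proper_card.
  apply/properP; split; first by apply/fintype.subsetP => u; rewrite !inE /h'; case: (u == u0).
  by exists u0; rewrite !inE ?hu0 // /h' eqxx.
- move=> u v c; rewrite /h'; case: eqP => [->|_]; case: eqP => [->|_] // e1 e2.
  + by case: e1 e2 => <- /hc0.
  + by case: e2 e1 => <- /hc0.
  + exact: hinj e1 e2.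
move=> s hs; exists s => u c huc; apply: hs; rewrite /h'; case: eqP => // uE.
by move: huc; rewrite uE hu0.
Qed.

Variable K : eqType.

Lemma letter_action_completion (T : finType) (h : K -> T -> option T) :
  (forall y u v c, h y u = Some c -> h y v = Some c -> u = v) ->
  exists2 m : K * bool -> T -> T, letter_action m &
    forall y u c, h y u = Some c -> m (y, false) u = c.
Proof.
move=> hinj.
have /choice[s hs] y := partial_injection_extends (hinj y).
exists (fun l => if l.2 then (s l.1)^-1%g : {perm T} else s l.1) => //.
by case=> y [] v /=; rewrite ?permKV ?permK.
Qed.

(** Cuts a finite action out of a possibly infinite graph: edges inside [s] are kept, loose ends are
    joined in some way. *)
Lemma letter_action_sub (Y : choiceType) (h : K -> Y -> Y) (s : seq Y) :
  (forall y, injective (h y)) ->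
  exists2 m : K * bool -> seq_sub s -> seq_sub s, letter_action m &
    forall y u v, h y (val u) = val v -> m (y, false) u = v.
Proof.
move=> hinj; pose h' y (u : seq_sub s) : option (seq_sub s) := insub (h y (val u)).
have h'E y u c : h' y u = Some c -> h y (val u) = val c.
  by rewrite /h'; case: insubP => // c' _ <- [->].
have [y u v c /h'E uc /h'E vc|m mP hm] := @letter_action_completion _ h'.
  by apply/val_inj/(hinj y); rewrite uc vc.
by exists m => // y u v huv; apply: hm; rewrite /h' huv valK.
Qed.

Lemma inverse_letter_iter (T : finType) (m : K * bool -> T -> T) y u :
  letter_action m -> exists k, m (y, true) u = wact m (pos (nseq k y)) u.
Proof.
move=> mP; have finj := letter_action_inj mP (l := (y, false)).
exists (fingraph.order (m (y, false)) u).-1.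
apply: (finj); have -> : (y, true) = linv (y, false) by [].
rewrite letter_actionV //; have := f_finv finj u; rewrite /finv => {1}<-; congr (m _ _).
by elim: _.-1 => //= k ->.
Qed.

(** On a finite set an inverse letter acts as a power of the letter, so some positive word leads to
    [t]. Cut at its first visit to [t], it never leaves [t], and a positive word can cross the edge
    in no other way. *)
Lemma positive_reach (T : finType) (m : K * bool -> T -> T) t z u w :
  letter_action m -> wact m w u = t ->
  exists2 p, wact m (pos p) u = t & avoids m t (z, false) (pos p) u.
Proof.
move=> mP wE.
have [p pE] : exists p, wact m (pos p) u = t.
  rewrite -{}wE; elim: w => [|[y e] w [p pE]]; first by exists [::].
  case: e; last by exists (y :: p); rewrite /= pE.
  have [k kE] := inverse_letter_iter y (wact m w u) mP.
  by exists (nseq k y ++ p); rewrite /pos map_cat wact_cat -/(pos p) pE /= kE.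
elim/last_ind: p u {wE} pE => [|p y IH] u pE; first by exists [::].
have [->|/eqP ut] := eqVneq u t; first by exists [::].
move: pE; rewrite /pos map_rcons -cats1 wact_cat => /IH[p' p'E ap].
exists (rcons p' y); rewrite /pos map_rcons -cats1 ?wact_cat //.
by apply/avoids_cat; split=> //=; split=> // -[[_ /ut]|[]].
Qed.

End Completion.

(** * Escaping through one edge *)

Section Escape.
Variables (K : choiceType) (T : finType) (m : K * bool -> T -> T).
Variables (t : T) (z a : K).
Hypotheses (mP : letter_action m) (az : a <> z).
Hypothesis reach_t : forall u, exists w, wact m w u = t.

(* The edge [z] leaving [t] is redirected to the root [inr [::]] of the tree of
   positive words, the letter read last being the head of the word. *)
Definition escape_step y (c : T + seq K) : T + seq K :=
  match c with
  | inl v => if (y == z) && (v == t) then inr [::] else inl (m (y, false) v)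
  | inr u => inr (y :: u)
  end.

Definition escape_run p c := foldr escape_step c p.

Lemma escape_step_inj y : injective (escape_step y).
Proof.
case=> [v|u] [v'|u'] //=.
- case: eqP => [->|_] /=; last by case=> /(letter_action_inj mP) ->.
  case: eqP => [->|vt]; case: eqP => [->|v't] //=.
  by case=> /(letter_action_inj mP) ->.
- by case: ifP.
- by case: ifP.
- by case=> ->.
Qed.

Lemma escape_run_inj p : injective (escape_run p).
Proof. by elim: p => //= y p IH c c' /escape_step_inj /IH. Qed.

Lemma escape_run_cat p q c : escape_run (p ++ q) c = escape_run p (escape_run q c).
Proof. exact: foldr_cat. Qed.

Lemma escape_run_tree p u : escape_run p (inr u) = inr (p ++ u).
Proof. by elim: p => //= y p ->. Qed.

Lemma escape_run_size p v s : escape_run p (inl v) = inr s -> size s <= size p.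
Proof.
elim: p s => //= y p IH s; case: escape_run IH => [v' _|u IH] /=.
  by case: ifP => // _ [<-].
by case=> <- /=; rewrite ltnS IH.
Qed.

Lemma escape_run_avoids p v : avoids m t (z, false) (pos p) v ->
  escape_run p (inl v) = inl (wact m (pos p) v).
Proof.
elim: p => //= y p IH [/IH-> nc] /=; case: ifP => // /andP[/eqP yz /eqP vt].
by case: nc; left; rewrite yz.
Qed.

(** Vertices are treated one by one: the word is prolonged until the next vertex reaches [t] and
    takes [z] into the tree, which positive words never leave. *)
Lemma common_escape : exists p, forall v, exists s, escape_run p (inl v) = inr s.
Proof.
suff [p hp] : exists p, forall v, v \in enum T ->
    exists s, escape_run p (inl v) = inr s.
  by exists p => v; apply: hp; rewrite mem_enum.
elim: (enum T) => [|v A [p hp]]; first by exists [::].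
have [q hq] : exists q s, escape_run (q ++ p) (inl v) = inr s.
  case E: (escape_run p (inl v)) => [v'|s]; last by exists [::], s.
  have [w wE] := reach_t v'; have [q qE aq] := positive_reach z mP wE.
  exists (z :: q), [::].
  by rewrite /= escape_run_cat E escape_run_avoids // qE /= !eqxx.
exists (q ++ p) => u; rewrite inE => /predU1P[->//|/hp[s sE]].
by exists (q ++ s); rewrite escape_run_cat sE escape_run_tree.
Qed.

(** The conjugate of [z] by [p] realizes [sigma]. The last clause ensures that an edge leaving a
    leaf is not crossed while [p] is read. The graph is built on [T + seq K] and then cut down to
    the points visited. *)
Lemma escape (sigma : T -> T) : injective sigma ->
  exists (W : finType) (m' : K * bool -> W -> W) (iota : T -> W) (p : seq K),
    [/\ letter_action m', injective iota,
        forall y v, ~ (y = z /\ v = t) ->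
          m' (y, false) (iota v) = iota (m (y, false) v),
        forall v, m' (z, false) (wact m' (pos p) (iota v)) =
                  wact m' (pos p) (iota (sigma v))
      & p <> [::] /\ forall v v' p1 y p2, p = p1 ++ y :: p2 ->
          wact m' (pos p2) (iota v) <> wact m' (pos p) (iota v')].
Proof.
move=> sigma_inj; have [p0 /choice[s0 s0E]] := common_escape.
(* [M] bounds the length of every tail [s0 v]; a leaf occurring properly inside another would have
   its leading [a] in the block of [z]'s. *)
pose M := size p0; pose p := a :: nseq M z ++ p0.
pose U v := a :: nseq M z ++ s0 v.
have s0M v : size (s0 v) <= M by apply: escape_run_size (s0E v).
have pU v : escape_run p (inl v) = inr (U v).
  by rewrite /p /= escape_run_cat s0E escape_run_tree.
have U_inj : injective U.
  by move=> v v' E; apply/inl_inj/(@escape_run_inj p); rewrite !pU E.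
have inrU v v' : inr (U v) = inr (U v') :> T + seq K -> v = v'.
  by case=> E; apply: U_inj; rewrite /U E.
(* The long block of [z]'s closed by [a] occurs at only one place. *)
have U_suffix v v' q : U v' = q ++ U v -> q = [::].
  case: q => // y q E; have /(congr1 size) := E.
  rewrite /= !size_cat /= !size_cat !size_nseq => szE.
  have := s0M v'; have qM : size q < M by have := s0M v'; lia.
  have := congr1 (fun u => nth a u (size q).+1) E.
  by rewrite /= !nth_cat size_nseq qM nth_nseq qM ltnn subnn /= => /esym/az.
(* Only [z] at a leaf changes: it permutes the leaves instead of growing the tree. Leaves begin with
   [a], so no other [z]-edge ends at one. *)
pose f y c := if [pick v | c == inr (U v)] is Some v then
    (if y == z then inr (U (sigma v)) else escape_step y c) else escape_step y c.
have fU v : f z (inr (U v)) = inr (U (sigma v)).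
  rewrite /f; case: pickP => [v' /= /eqP/inrU ->|/(_ v)]; by rewrite eqxx.
have fN y c : (y = z -> forall v, c <> inr (U v)) -> f y c = escape_step y c.
  rewrite /f => H; case: pickP => // v /eqP cE; case: eqP => // yz.
  by case: (H yz v).
have fE y c : (exists2 v, y = z /\ c = inr (U v) & f y c = inr (U (sigma v))) \/
    f y c = escape_step y c.
  have [yz|/eqP yz] := eqVneq y z; last by right; apply: fN => /yz.
  case: (pselect (exists v, c = inr (U v))) => [[v cE]|/forallNP H].
    by left; exists v => //; rewrite yz cE fU.
  by right; apply: fN.
have Uz v c : inr (U v) <> escape_step z c.
  by case: c => [v'|u] /=; [case: ifP|case=> /az].
have f_inj y : injective (f y).
  move=> c c'.
  case: (fE y c) => [[v [yz ->]]|] ->; case: (fE y c') => [[v' [yz' ->]]|] ->.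
  - by move=> /inrU/sigma_inj ->.
  - by rewrite yz => /Uz.
  - by rewrite yz' => /esym/Uz.
  - exact: escape_step_inj.
(* A leaf met before the end of [p] would be a proper suffix of the final leaf. *)
have f_run p1 p2 v : p = p1 ++ p2 -> foldr f (inl v) p2 = escape_run p2 (inl v).
  elim: p2 p1 => //= y p2 IH p1 pE.
  rewrite (IH (rcons p1 y)) ?cat_rcons // fN // => yz v' E.
  have := pU v; rewrite pE escape_run_cat /= E /= escape_run_tree =>
    /(congr1 (fun c => if c is inr u then u else [::])).
  by rewrite -cat_rcons => /esym/U_suffix; case: (p1).
pose s := [seq escape_run (drop i p) (inl v) | v <- enum T, i <- iota 0 (size p).+1].
have in_s p1 p2 v : p = p1 ++ p2 -> escape_run p2 (inl v) \in s.
  move=> pE; apply/allpairsP; exists (v, size p1); split.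
  - by rewrite mem_enum.
  - by rewrite mem_iota pE size_cat /=; lia.
  - by rewrite pE drop_size_cat.
have [m' m'P hm'] := letter_action_sub s f_inj.
pose io v : seq_sub s := SeqSub (in_s p [::] v (esym (cats0 p))).
have run p1 p2 v : p = p1 ++ p2 ->
    val (wact m' (pos p2) (io v)) = escape_run p2 (inl v).
  elim: p2 p1 => //= y p2 IH p1 pE.
  rewrite (hm' y _ (SeqSub (in_s _ (y :: p2) v pE))) //=.
  rewrite (IH (rcons p1 y)) ?cat_rcons //.
  by have := f_run _ _ v pE; rewrite /= (f_run (rcons p1 y)) ?cat_rcons.
exists (seq_sub s), m', io, p; split=> //.
- by move=> v v' /(congr1 val) /= [].
- move=> y v yz; apply: hm'; rewrite /= fN //=.
  by case: ifP => // /andP[/eqP ? /eqP ?]; case: yz.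
- by move=> v; apply: hm'; rewrite !(run [::]) // !pU fU.
- split=> // v v' p1 y p2 pE /(congr1 val).
  rewrite (run [::] p) // (run (rcons p1 y)) ?cat_rcons // pU => E.
  have := pU v; rewrite pE -cat_rcons escape_run_cat E escape_run_tree =>
    /(congr1 (fun c => if c is inr u then u else [::])).
  by move=> /esym/U_suffix; case: (p1).
Qed.

End Escape.

(** * Stages and their extensions *)

Section Stages.
Variable K : choiceType.

(* A finite transitive action on [0, n), one edge of which (the letter [edge_letter]
   leaving [edge_src]) may still be changed; all other edges are final. *)
Record stage := Stage {
  bound : nat;
  sact : K * bool -> nat -> nat;
  edge_src : nat;
  edge_letter : K;
  sactP : letter_action sact;
  sact_lt : forall l v, v < bound -> sact l v < bound;
  edge_src_lt : edge_src < bound;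
  stage_reach : forall u, u < bound -> exists w, wact sact w u = edge_src }.

Definition savoids (G : stage) :=
  avoids (sact G) (edge_src G) (edge_letter G, false).

(** With both ends of the new distinguished edge beyond the old points, no later extension changes
    an edge at an old point. *)
Definition extends (G H : stage) :=
  [/\ bound G <= bound H,
      forall y v, v < bound G -> ~ (y = edge_letter G /\ v = edge_src G) ->
        sact H (y, false) v = sact G (y, false) v,
      bound G <= edge_src H
    & bound G <= sact H (edge_letter H, false) (edge_src H)].

Lemma extends_trans G H I : extends G H -> extends H I -> extends G I.
Proof.
case=> gh agh tgh sgh [hi ahi thi shi]; split=> *.
- exact: leq_trans hi.
- rewrite ahi ?agh //; first exact: leq_trans gh.
  by case=> _ vE; move: tgh; rewrite -vE; lia.
- exact: leq_trans thi.
- exact: leq_trans shi.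
Qed.

Lemma extends_word G H w v : extends G H -> v < bound G -> savoids G w v ->
  wact (sact H) w v = wact (sact G) w v.
Proof.
case=> gh agh tgh sgh vG aw.
exact: (transfer_word (P := fun v => v < bound G) (j := id) (@sactP G) (@sactP H)
  (@sact_lt G) agh vG aw).
Qed.

Definition oact (G : stage) l (i : 'I_(bound G)) : 'I_(bound G) :=
  Ordinal (sact_lt l (ltn_ord i)).

Definition osrc (G : stage) : 'I_(bound G) := Ordinal (edge_src_lt G).

Lemma oactP G : letter_action (@oact G).
Proof. by move=> l i; apply/val_inj/sactP. Qed.

Lemma wact_oact G w i : val (wact (@oact G) w i) = wact (sact G) w (val i).
Proof. by elim: w => //= l w ->. Qed.

Lemma oact_reach G i : exists w, wact (@oact G) w i = osrc G.
Proof.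
have [w wE] := stage_reach (ltn_ord i).
by exists w; apply/val_inj; rewrite wact_oact.
Qed.

(** * Turning a finite action that contains a stage into a new stage *)

Section Renumbering.
Variables (G : stage) (W : finType) (mW : K * bool -> W -> W).
Variables (io : 'I_(bound G) -> W) (t' : W) (z' : K).
Hypotheses (mWP : letter_action mW) (io_inj : injective io).
Hypothesis agree : forall y v, ~ (y = edge_letter G /\ v = osrc G) ->
  mW (y, false) (io v) = io (oact (y, false) v).
Hypotheses (z'E : z' <> edge_letter G) (t'N : forall v, io v <> t').

Definition reached c := exists u w, wact mW w (io u) = c.

Hypothesis t'reached : reached t'.

(** Inside [G] the source is reached without crossing the one edge that [mW] may have changed, so
    the path survives in [W]. *)
Lemma io_connected u : exists w, wact mW w (io u) = io (osrc G).
Proof.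
have [w wE] := oact_reach u.
have [p pE ap] := positive_reach (edge_letter G) (@oactP G) wE.
exists (pos p); rewrite -pE.
exact: (transfer_word (P := fun=> True) (j := io) (@oactP G) mWP _ (fun y v _ => @agree y v)).
Qed.

Lemma reached_io u : reached (io u).
Proof. by exists u, [::]. Qed.

Lemma reached_word w c : reached c -> reached (wact mW w c).
Proof. by case=> u [w' <-]; exists u, (w ++ w'); rewrite wact_cat. Qed.

Lemma reached_letter l c : reached c -> reached (mW l c).
Proof. exact: (@reached_word [:: l]). Qed.

Lemma reached_to c : reached c -> exists w, wact mW w c = t'.
Proof.
case=> u [w <-]; have [u' [w' <-]] := t'reached.
have [q qE] := io_connected u; have [q' q'E] := io_connected u'.
exists (w' ++ winv q' ++ q ++ winv w).
by rewrite !wact_cat wactV // qE -q'E wactV.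
Qed.

(** A stage is transitive, so only the points reached from [G] are kept; the image of [io] is listed
    first, so that old points keep their numbers. *)
Lemma stage_extension : exists (H : stage) (phi : W -> nat),
  [/\ extends G H, forall u, phi (io u) = u,
      forall l c, reached c -> sact H l (phi c) = phi (mW l c),
      forall c, reached c -> phi c < bound H
    & forall w c, reached c -> avoids mW t' (z', false) w c ->
        savoids H w (phi c)].
Proof.
pose s1 := [seq io i | i <- enum 'I_(bound G)].
pose s2 := [seq c <- enum W | `[< reached c >] && (c \notin s1)].
pose s := s1 ++ s2.
have s1E c : c \in s1 -> exists u, io u = c.
  by case/mapP=> u _ ->; exists u.
have size_s1 : size s1 = bound G by rewrite size_map size_enum_ord.
have uniq_s : uniq s.
  rewrite cat_uniq map_inj_uniq // enum_uniq filter_uniq ?enum_uniq // andbT /=.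
  by apply/hasPn => c; rewrite mem_filter => /andP[/andP[]].
have mem_s c : (c \in s) = `[< reached c >].
  rewrite mem_cat mem_filter mem_enum andbT.
  case: (boolP (c \in s1)) => [/s1E[u <-]|_]; rewrite ?orbT ?andbT ?andbF //=.
  by apply/esym/asboolP/reached_io.
have in_s c : reached c -> c \in s by rewrite mem_s => /asboolP.
have reached_nth v : v < size s -> reached (nth t' s v).
  by move=> vs; apply/asboolP; rewrite -mem_s mem_nth.
pose phi c := index c s.
have phi_lt c : reached c -> phi c < size s by move=> /in_s; rewrite index_mem.
have phiK c : reached c -> nth t' s (phi c) = c by move=> /in_s/nth_index->.
have phi_inj c c' : reached c -> reached c' -> phi c = phi c' -> c = c'.
  by move=> rc rc' E; rewrite -(phiK c) // E phiK.
have phi_io u : phi (io u) = u.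
  rewrite /phi index_cat map_f ?mem_enum // index_map // index_enum_ord //.
have phi_ge c : (forall v, io v <> c) -> bound G <= phi c.
  move=> cN; rewrite /phi index_cat.
  case: (boolP (c \in s1)) => [/s1E[u /cN]//|_]; rewrite size_s1; exact: leq_addr.
(* The identity beyond the listed points keeps [m'] a letter action on all of [nat]. *)
pose m' l v := if v < size s then phi (mW l (nth t' s v)) else v.
have m'E l c : reached c -> m' l (phi c) = phi (mW l c).
  by move=> rc; rewrite /m' phi_lt // phiK.
have m'P : letter_action m'.
  move=> l v; case: (boolP (v < size s)) => vs; last by rewrite /m' !ifN.
  have -> : m' l v = phi (mW l (nth t' s v)) by rewrite /m' vs.
  rewrite m'E ?mWP /phi ?index_uniq //; exact/reached_letter/reached_nth.
have m'_lt l v : v < size s -> m' l v < size s.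
  by move=> vs; rewrite /m' vs; apply/phi_lt/reached_letter/reached_nth.
have m'W w c : reached c -> wact m' w (phi c) = phi (wact mW w c).
  by move=> rc; elim: w => //= l w ->; rewrite m'E //; apply: reached_word.
have m'_reach u : u < size s -> exists w, wact m' w u = phi t'.
  move=> us; have [w wE] := reached_to (reached_nth _ us); exists w.
  by rewrite -wE -m'W ?/phi ?index_uniq //; apply: reached_nth.
exists (Stage z' m'P m'_lt (phi_lt _ t'reached) m'_reach), phi.
split=> //=; last first.
- move=> w c rc; rewrite /savoids /=; elim: w => //= l w IH [/IH aw nc].
  split=> //; rewrite m'W //; have rw := reached_word w rc.
  move=> [[lE /phi_inj E]|[lE]]; first by apply: nc; left; rewrite E.
  rewrite m'E // => /phi_inj E; apply: nc; right; rewrite E //.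
  exact: reached_letter.
- split=> /=.
  + by rewrite size_cat size_s1 leq_addr.
  + move=> y v vG nyv; pose u := Ordinal vG.
    have -> : v = phi (io u) by rewrite phi_io.
    rewrite m'E; last exact: reached_io.
    rewrite agree ?phi_io // => -[yE uE]; apply: nyv; split=> //.
    by have /(congr1 val) := uE.
  + exact: phi_ge.
  (* Were the far end of the new edge in the image of [io], going back along [z'], which is not the
     letter of the changed edge, would put [t'] there too. *)
  + rewrite m'E //; apply: phi_ge => v vE.
    apply: (t'N (v := oact (z', true) v)).
    rewrite -(transfer_letter (P := fun=> True) (@oactP G) mWP _ (fun y v _ => @agree y v)) //.
      by rewrite vE; apply: (mWP (z', false)).
    by case=> [[]|[[/z'E]]].
Qed.

End Renumbering.

Hypothesis other_letter : forall z : K, exists a, a <> z.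

(** The witness is [z] conjugated by the escape word. The new edge, labelled [a], leaves a leaf;
    leaves are met only once [p] is fully read, where the next letter is [z]. *)
Lemma extension_permuting G (sigma : 'I_(bound G) -> 'I_(bound G)) :
  injective sigma ->
  exists2 H, extends G H & exists g, forall v : 'I_(bound G),
    wact (sact H) g v = sigma v /\ savoids H g v.
Proof.
move=> sigma_inj; have [a az] := other_letter (edge_letter G).
have [W [m' [io [p [m'P io_inj agree zE [pN pE]]]]]] :=
  escape (@oactP G) az (@oact_reach G) sigma_inj.
pose t' := wact m' (pos p) (io (osrc G)).
have t'N v : io v <> t'.
  rewrite /t'; case: (p) pN pE => // y p' _ pE.
  by apply: (pE _ _ (belast y p') (last y p') [::]); rewrite cats1 -lastI.
have rt' : reached m' io t' by exists (osrc G), (pos p).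
have [H [phi [GH phi_io phi_act phi_lt phi_av]]] :=
  stage_extension m'P io_inj agree az t'N rt'.
pose z := edge_letter G.
exists H => //; exists (winv (pos p) ++ (z, false) :: pos p) => v.
have phi_w w c : reached m' io c -> wact (sact H) w (phi c) = phi (wact m' w c).
  by move=> rc; elim: w => //= l w ->; rewrite phi_act //; apply: reached_word.
have av u : avoids m' t' (a, false) (pos p) (io u).
  suff H0 p1 p2 : p = p1 ++ p2 -> avoids m' t' (a, false) (pos p2) (io u).
    exact: (H0 [::]).
  elim: p2 p1 => //= y p2 IH p1 pE'; split; first by apply: (IH (rcons p1 y)); rewrite cat_rcons.
  by case=> [[_]|[]//]; apply: pE pE'.
rewrite -(phi_io v) phi_w; last exact: reached_io.
split.
  by rewrite wact_cat /= zE wactV // phi_io.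
apply: phi_av; first exact: reached_io.
apply/avoids_cat; split=> /=.
  by split=> // -[[[/esym/az]]|[]].
by rewrite zE; apply: avoidsV.
Qed.

(** Even the identity permutation makes the bound grow, as the new edge starts beyond the old
    points. *)
Lemma extension_large G N : exists2 H, extends G H & N <= bound H.
Proof.
have step G' : exists2 H, extends G' H & bound G' < bound H.
  have [H GH _] := extension_permuting (@inj_id 'I_(bound G')).
  by exists H => //; case: GH => _ _ h _; apply: leq_ltn_trans h (edge_src_lt H).
elim: N => [|N [H GH NH]]; first by have [H GH _] := step G; exists H.
have [I HI hI] := step H; exists I; first exact: extends_trans HI.
exact: leq_ltn_trans hI.
Qed.

(** In a stage containing all the entries, the matching of [s] with [s'] completes to a permutation
    of the points. *)
Lemma extension_moving G (s s' : seq nat) :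
  size s = size s' -> uniq s -> uniq s' ->
  exists2 H, extends G H & exists g, forall j, j < size s ->
    [/\ nth 0 s j < bound H, savoids H g (nth 0 s j)
      & wact (sact H) g (nth 0 s j) = nth 0 s' j].
Proof.
move=> ss us us'.
have [G1 GG1 bG1] := extension_large G (\max_(i <- s ++ s') i).+1.
have s_lt i : i \in s ++ s' -> i < bound G1.
  by move=> is_; apply: leq_trans bG1; rewrite ltnS (leq_bigmax_seq (F := id)).
pose h (i : 'I_(bound G1)) : option 'I_(bound G1) :=
  if val i \in s then insub (nth 0 s' (index (val i) s)) else None.
have hE u c : h u = Some c -> val u \in s /\ val c = nth 0 s' (index (val u) s).
  by rewrite /h; case: ifP => // us_; case: insubP => // c' _ <- [->].
have [u v c /hE[us_ uE] /hE[vs_ vE]|sigma hs] := @partial_injection_extends _ h.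
  apply/val_inj; rewrite -(nth_index 0 us_) -(nth_index 0 vs_); congr nth.
  by apply/eqP; rewrite -(nth_uniq 0 _ _ us') -?ss ?index_mem // -uE vE.
have [H G1H [g hg]] := extension_permuting (@perm_inj _ sigma).
exists H; first exact: extends_trans G1H.
exists g => j js.
have jG : nth 0 s j < bound G1 by apply: s_lt; rewrite mem_cat mem_nth.
have j'G : nth 0 s' j < bound G1 by apply: s_lt; rewrite mem_cat mem_nth -?ss ?orbT.
have [gE ga] := hg (Ordinal jG); split=> //.
  by case: G1H => h1 _ _ _; apply: leq_trans h1.
rewrite gE; suff -> : sigma (Ordinal jG) = Ordinal j'G by [].
apply: hs; rewrite /h /= mem_nth // index_uniq //.
by case: insubP => [c _ cE|/negP//]; congr Some; apply/val_inj.
Qed.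

End Stages.

(** * Splicing *)

Section Splicing.
Variable K : choiceType.
Hypothesis other_letter : forall z : K, exists a, a <> z.

(** The trace left in a finite action by a subgroup of infinite index, [ws] standing for its
    generators. *)
Definition loops_off_edge (ws : seq (seq (K * bool))) :=
  exists (T : finType) (m : K * bool -> T -> T) (d0 t : T) (z : K),
    [/\ letter_action m, forall u, exists w, wact m w u = t
      & forall w, w \in ws -> wact m w d0 = d0 /\ avoids m t (z, false) w d0].

(** Since the distinguished edge is avoided, the invariance of [C] persists in every extension. *)
Definition closed_under (H : stage K) (ws : seq (seq (K * bool))) (C : nat -> Prop) :=
  forall v, C v -> v < bound H /\
    forall w, w \in ws -> savoids H w v /\ C (wact (sact H) w v).

(* The copy of [0, n) is joined to a finite set of functions [T -> W] by exchanging
   the ends of two edges.  Reading a loop based at [d0 : T] along a path of the joined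
   action, whenever the path is at a function [f] the loop is at a point of the image
   of [f]; hence the path never visits a function whose image misses [T]. *)
Lemma extension_closing (G : stage K) ws : loops_off_edge ws ->
  exists2 H, extends G H &
    forall s, s < bound G -> exists2 C, C s & closed_under H ws C.
Proof.
case=> T [m [d0 [tL [zL [mP mreach hws]]]]].
have [a azL] := other_letter zL.
have [W [mW [io [p [mWP io_inj agree _ [pN pE]]]]]] :=
  escape mP azL mreach (@inj_id T).
have io_off x d : wact mW (pos p) (io x) <> io d.
  case: (p) pN pE => // y p' _ pE E.
  apply: (pE d x (belast y p') (last y p') [::]); last by rewrite E.
  by rewrite cats1 -lastI.
have io_letter l d : ~ crosses m tL (zL, false) l d -> mW l (io d) = io (m l d).
  exact: (transfer_letter (P := fun=> True) mP mWP _ (fun y v _ => @agree y v)).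
pose V := {ffun T -> W}.
pose mV l (f : V) : V := [ffun x => mW l (f x)].
have mVP : letter_action mV by move=> l f; apply/ffunP => x; rewrite !ffunE mWP.
have mVw w (f : V) : wact mV w f = [ffun x => wact mW w (f x)].
  by elim: w => [|l w /= ->]; apply/ffunP => x; rewrite !ffunE.
(* [e0] is [io] itself and [e1] its predecessor along [zG]; after the exchange by [tau], the edge
   [zG] from [tG] ends at [e0]. *)
pose zG := edge_letter G; pose tG := osrc G.
pose e0 : V := [ffun x => io x]; pose e1 := mV (zG, true) e0.
pose Y : finType := ('I_(bound G) + V)%type.
pose mb l (c : Y) : Y := match c with inl v => inl (oact l v) | inr f => inr (mV l f) end.
have mbP : letter_action mb by move=> l [v|f] /=; rewrite ?oactP ?mVP.
pose tau : {perm Y} := tperm (inl tG) (inr e1).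
pose mY l (c : Y) : Y :=
  if l.1 == zG then (if l.2 then tau (mb l c) else mb l (tau c)) else mb l c.
have mYP : letter_action mY.
  case=> y e c; rewrite /mY /=; case: eqP => _; last by have := mbP (y, e) c; rewrite /linv.
  by case: e => /=; rewrite /tau ?tpermK ?mbP ?tpermK.
have [z' z'E] := other_letter zG.
have agreeG y v : ~ (y = zG /\ v = tG) -> mY (y, false) (inl v) = inl (oact (y, false) v).
  move=> nyv; rewrite /mY /=; case: eqP => // yE; rewrite /tau tpermD //.
  by apply/eqP => -[vE]; apply: nyv.
have agreeV y f : True -> ~ (y = zG /\ f = e1) -> mY (y, false) (inr f) = inr (mV (y, false) f).
  move=> _ nyf; rewrite /mY /=; case: eqP => // yE; rewrite /tau tpermD //.
  by apply/eqP => -[fE]; apply: nyf.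
(* Reading [p] moves the image of [io] off itself, so this map is never visited and can carry the
   new edge. *)
pose tV := wact mV (pos p) e0; pose t' : Y := inr tV.
have rt' : reached mY inl t'.
  have [w1 w1E] : exists w, wact mY w (inr e0) = inr e1.
    have [//|q qE aq] := positive_reach (u := e0) (w := [:: (zG, true)]) zG mVP (t := e1).
    exists (pos q); rewrite -qE.
    exact: (transfer_word (P := fun=> True) (j := inr) mVP mYP _ agreeV).
  have [w2 w2E] : exists w, wact mY w t' = inr e1.
    have [|q qE aq] := positive_reach (u := tV) (w := (zG, true) :: winv (pos p)) zG mVP (t := e1).
      by rewrite /= wactV.
    exists (pos q); rewrite -qE.
    exact: (transfer_word (P := fun=> True) (j := inr) mVP mYP _ agreeV).
  (* Cross the exchanged edge from [tG] to [e0], go on to [e1] among the maps, and from there back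
     to [t']. *)
  exists tG, (winv w2 ++ w1 ++ [:: (zG, false)]); rewrite !wact_cat /=.
  have -> : mY (zG, false) (inl tG) = inr e0.
    rewrite /mY /= eqxx /tau tpermL /= /e1; congr inr; exact: (mVP (zG, true)).
  by rewrite w1E -w2E wactV.
have [//|H [phi [GH phi_io phi_act phi_lt phi_av]]] :=
  stage_extension (t' := t') mYP (@inl_inj _ _) agreeG z'E _ rt'.
pose Inv (c : Y) d := if c is inr f then exists x, f x = io d else True.
have Inv_b l c d : ~ crosses m tL (zL, false) l d -> Inv c d -> Inv (mb l c) (m l d).
  case: c => //= f nc [x fx]; exists x; rewrite ffunE fx; exact: io_letter.
(* The exchanged edges enter the maps at [e0], whose image contains every [io d], or at [e1] by the
   inverse of [zG], where [io_letter] applies to the step of the loop. *)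
have Inv_step l c d : ~ crosses m tL (zL, false) l d -> Inv c d -> Inv (mY l c) (m l d).
  move=> nc I; rewrite /mY; case: l nc => y e nc /=.
  case: eqP => [yE|_]; last exact: Inv_b.
  case: e nc => nc.
    have := Inv_b _ _ _ nc I; rewrite /tau; case: tpermP => [-> _||] //=.
    by exists d; rewrite !ffunE -yE; apply: io_letter.
  rewrite /tau; case: tpermP => [_|//|_ _]; last exact: Inv_b.
  exists (m (y, false) d); rewrite /e1 /= yE.
  by rewrite (mVP (zG, true)) ffunE.
have Inv_t' d : ~ Inv t' d.
  by case=> x; rewrite /tV mVw !ffunE; apply: io_off.
have Inv_word w c d : avoids m tL (zL, false) w d -> Inv c d ->
    avoids mY t' (z', false) w c /\ Inv (wact mY w c) (wact m w d).
  move=> aw I; elim: w aw => //= l w IH [/IH[aY Iw] nc].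
  have Il := Inv_step _ _ _ nc Iw; do 2?split=> //.
  move=> [[_ cE]|[lE cE]]; first by apply: (Inv_t' (wact m w d)); rewrite -cE.
  by apply: (Inv_t' (m l (wact m w d))); move: Il; rewrite cE lE mYP.
exists H => // s sG.
(* [Inv] puts no condition on the copy of the stage, so all old points share this set. *)
exists (fun v => exists c, [/\ phi c = v, reached mY inl c & Inv c d0]).
  by exists (inl (Ordinal sG)); split; rewrite ?phi_io //; apply: reached_io.
move=> v [c [<- rc I]]; split=> [|w /hws[wE aw]]; first exact: phi_lt.
have [aY Iw] := Inv_word w c d0 aw I.
split; first exact: phi_av.
exists (wact mY w c); split; last by rewrite -wE.
  by elim: (w) => //= l w' <-; rewrite phi_act //; apply: reached_word.
exact: reached_word.
Qed.

End Splicing.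

(** * The limit action *)

Section Limit.
Variable K : choiceType.

(** [R i] is the task number [i], carried out when passing from [G i] to [G i.+1]; away from its
    distinguished edge each stage is final. *)
Lemma limit_action (G0 : stage K) (R : nat -> stage K -> Prop) :
  (forall i G, exists2 H, extends G H & R i H) ->
  exists2 m : K * bool -> nat -> nat, letter_action m &
    forall i, exists2 H, R i H & forall w v, v < bound H -> savoids H w v ->
      wact m w v = wact (sact H) w v.
Proof.
move=> dense; have /choice[f hf] (iG : nat * stage K) : exists H, extends iG.2 H /\ R iG.1 H.
  by have [H] := dense iG.1 iG.2; exists H.
pose G := fix G k := if k is k'.+1 then f (k', G k') else G0.
have ext k : extends (G k) (G k.+1) by case: (hf (k, G k)).
have ext_lt j k : j < k -> extends (G j) (G k).
  elim: k => // k IH; rewrite ltnS leq_eqVlt => /predU1P[->//|/IH].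
  by move/extends_trans; apply.
have bound_ge k : k <= bound (G k).
  elim: k => // k IH; apply: leq_ltn_trans IH _; case: (ext k) => _ _ h _.
  exact: leq_ltn_trans h (edge_src_lt _).
have bound_mono j k : j <= k -> bound (G j) <= bound (G k).
  by rewrite leq_eqVlt => /predU1P[->//|/ext_lt[]].
have stable j k l v : v < bound (G k) -> k < j -> sact (G j) l v = sact (G k.+1) l v.
  move=> vk; rewrite leq_eqVlt => /predU1P[<-//|/ext_lt E].
  apply: (extends_word (w := [:: l]) E).
    exact: leq_trans vk (bound_mono _ _ (leqnSn k)).
  case: (ext k) => _ _ h1 h2; split=> // -[[_ /= vE]|[_ /= vE]].
    by move: h1; rewrite -vE; lia.
  by move: h2; rewrite -vE; lia.
(* [v] is below the bound of [G v.+1], and from the next stage on the edges at [v] are fixed. *)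
pose m l v := sact (G v.+2) l v.
have mE j k l v : v < bound (G k) -> k < j -> m l v = sact (G j) l v.
  move=> vk kj; rewrite /m (stable j k) // -(stable (maxn j v.+2) k) //; last by lia.
  by rewrite (stable (maxn j v.+2) v.+1) //; lia.
exists m.
  move=> l v; pose u := m l v; pose k := (maxn u v).+1.
  have [uk vk] : u < bound (G k) /\ v < bound (G k) by have := bound_ge k; lia.
  by rewrite -/u (mE k.+1 k) // /u (mE k.+1 k) // sactP.
move=> i; exists (G i.+1); first by case: (hf (i, G i)).
move=> w v vi; elim: w => //= l w IH [aw nc]; rewrite IH //.
have wi : wact (sact (G i.+1)) w v < bound (G i.+1).
  by elim: (w) => //= l' w' /sact_lt.
rewrite (mE i.+2 i.+1) //; apply: (extends_word (w := [:: l]) (ext _)) => //.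
Qed.

End Limit.

Local Open Scope classical_set_scope.

(** * Existence, for a free group given by its evaluation of words *)

Section FreeGroup.
Variables (F : groupType) (K : finType) (ev : seq (K * bool) -> F).
Hypothesis ev_cat : forall w w', ev (w ++ w') = (ev w * ev w')%g.
Hypothesis ev_inv : forall w, ev (winv w) = (ev w)^-1%g.
Hypothesis ev_surj : forall g, exists w, ev w = g.
Hypothesis ev_free : forall (T : Type) (m : K * bool -> T -> T), letter_action m ->
  forall w w', ev w = ev w' -> forall v, wact m w v = wact m w' v.
Hypothesis other_letter : forall z : K, exists a, a <> z.

Lemma ev_nil : ev [::] = 1%g.
Proof. by apply: (mulgI (ev [::])); rewrite -ev_cat mulg1. Qed.

Lemma ev_cons l w : ev (l :: w) = (ev [:: l] * ev w)%g.
Proof. by rewrite -ev_cat. Qed.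

Section FreeAction.
Variables (S : Type) (m : K * bool -> S -> S).
Hypothesis mP : letter_action m.

(** By [ev_free] the choice of a word for [g] has no effect. *)
Definition free_act g v := wact m (sval (cid (ev_surj g))) v.

Lemma free_actE w v : free_act (ev w) v = wact m w v.
Proof. by rewrite /free_act; case: cid => w' /= E; apply: ev_free. Qed.

Lemma free_act1 v : free_act 1%g v = v.
Proof. by rewrite -ev_nil free_actE. Qed.

Lemma free_actM g h v : free_act (g * h)%g v = free_act g (free_act h v).
Proof.
have [w <-] := ev_surj g; have [w' <-] := ev_surj h.
by rewrite -ev_cat !free_actE wact_cat.
Qed.

Definition free_action := GroupAction free_act1 free_actM.

End FreeAction.

(** The cosets met while reading [ws] from [L] form a finite part [D0] of the Schreier graph. By
    infinite index some edge leaves [D0]; in a completion of [D0] its substitute is crossed by none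
    of the loops. *)
Lemma infinite_index_loops (L : set F) (ws : seq (seq (K * bool))) :
  is_subgroup L -> infinite_index L -> (forall w, w \in ws -> L (ev w)) ->
  loops_off_edge ws.
Proof.
move=> [L1 LM LV] Linf Lws.
pose mc l (c : set F) := [set (ev [:: l] * x)%g | x in c].
have evl l : (ev [:: linv l] * ev [:: l] = 1)%g.
  by rewrite -[[:: linv l]]/(winv [:: l]) ev_inv mulVg.
have mcP : letter_action mc.
  move=> l c; apply/seteqP; split=> x /=.
    by case=> _ [y cy <-] <-; rewrite mulgA evl mul1g.
  move=> cx; exists (ev [:: l] * x)%g; first by exists x.
  by rewrite mulgA evl mul1g.
have mcw w : wact mc w L = left_coset (ev w) L.
  elim: w => [|l w /= ->].
    by rewrite ev_nil; apply/seteqP; split=> x /=; [exists x; rewrite ?mul1g|case=> y Ly <-; rewrite mul1g].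
  rewrite (ev_cons l w); apply/seteqP; split=> x /=.
    by case=> _ [y Ly <-] <-; exists y; rewrite // mulgA.
  by case=> y Ly <-; exists (ev w * y)%g; [exists y|rewrite mulgA].
have mcL w : w \in ws -> wact mc w L = L.
  move=> /Lws Lw; rewrite mcw; apply/seteqP; split=> x /=.
    by case=> y Ly <-; apply: LM.
  by move=> Lx; exists ((ev w)^-1 * x)%g; [apply: LM => //; apply: LV|rewrite mulgA mulgV mul1g].
pose D0 : seq (set F) := L :: [seq wact mc (drop i w) L | w <- ws, i <- iota 0 (size w).+1].
have in_D0 w1 w2 : w1 ++ w2 \in ws -> wact mc w2 L \in D0.
  move=> hw; rewrite inE; apply/orP; right; apply/allpairsPdep.
  exists (w1 ++ w2), (size w1); split=> //; last by rewrite drop_size_cat.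
  by rewrite mem_iota size_cat /=; lia.
have h_inj y : injective (mc (y, false)) by apply: letter_action_inj.
have [m mP hm] := letter_action_sub D0 h_inj.
pose d0 : seq_sub D0 := SeqSub (mem_head _ _).
have hmV y (u v : seq_sub D0) : mc (y, true) (val u) = val v -> m (y, true) u = v.
  move=> E; rewrite -[v](mP (y, false)); congr m; apply/esym/hm.
  by rewrite -E; apply: (mcP (y, true)).
(* Were [D0] closed under positive letters, it would by finiteness be closed under inverses too,
   hence contain all cosets. *)
have [t [z tz]] : exists (t : seq_sub D0) z, mc (z, false) (val t) \notin D0.
  apply: contrapT => /forallNP H.
  have cl y (u : seq_sub D0) : mc (y, false) (val u) \in D0.
    by apply: contrapT => /negP h; case: (H u); exists y.
  have clV l c : c \in D0 -> mc l c \in D0.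
    move=> cD; case: l => y []; last exact: (cl y (SeqSub cD)).
    pose u := m (y, true) (SeqSub cD).
    have uE : m (y, false) u = SeqSub (cl y u) by apply: hm.
    have := mP (y, true) (SeqSub cD); rewrite /linv /= -/u uE => /(congr1 val) /= <-.
    by rewrite (mcP (y, false)); apply: ssvalP.
  apply: Linf; apply: (sub_finite_set _ (finite_seq D0)) => _ [x _ <-] /=.
  have [w <-] := ev_surj x; rewrite -mcw.
  by elim: w => [|l w IH] /=; [apply: mem_head|apply: clV].
have run w1 w2 : w1 ++ w2 \in ws ->
    val (wact m w2 d0) = wact mc w2 L /\ avoids m t (z, false) w2 d0.
  elim: w2 w1 => //= l w2 IH w1 hw.
  have [] := IH (rcons w1 l); first by rewrite cat_rcons.
  set u := wact m w2 d0 => uE au.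
  have lD := in_D0 _ (l :: w2) hw; rewrite /= -uE in lD *.
  have mE : m l u = SeqSub lD.
    by case: l hw lD => y [] hw lD; [apply: hmV|apply: hm].
  split; first by rewrite mE.
  split=> // -[[lE ut]|[lE uE']].
    by have := lD; rewrite lE ut (negPf tz).
  have tE : t = SeqSub lD by rewrite -mE lE uE' mP.
  move: tz; rewrite tE /= lE => /negP; apply.
  by rewrite (mcP (z, true)); apply: ssvalP.
have from_d0 (u : seq_sub D0) : exists w, wact m w d0 = u.
  have := ssvalP u; rewrite inE => /orP[/eqP uL|/allpairsPdep[w [i [hw _ uE]]]].
    by exists [::]; apply: val_inj; rewrite /= uL.
  exists (drop i w); apply: val_inj.
  by have [->] := run (take i w) (drop i w) ltac:(by rewrite cat_take_drop).
exists (seq_sub D0), m, d0, t, z; split=> //.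
  move=> u; have [w wE] := from_d0 u; have [w' w'E] := from_d0 t.
  by exists (w' ++ winv w); rewrite -wE wact_cat wactV.
move=> w hw; have [wE aw] := run [::] w hw; split=> //.
by apply: val_inj; rewrite wE mcL.
Qed.

Lemma initial_stage (z : K) : exists G : stage K, True.
Proof.
have mP : letter_action (fun (_ : K * bool) (v : nat) => v) by [].
have h u : u < 1 -> exists w : seq (K * bool), wact (fun _ v => v) w u = 0.
  by case: u => // _; exists [::].
by exists (@Stage K 1 _ 0 z mP (fun _ _ => id) isT h).
Qed.

Lemma exists_highly_transitive_locally_finite (z0 : K) :
  exists (S : Type) (a : group_action F S),
    [/\ infinite_set [set: S],
        highly_transitive a
      & forall L : set F, is_subgroup L -> finitely_generated L ->
          infinite_index L -> locally_finite_on a L].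
Proof.
(* A countable type of tasks: to move one tuple to another, or to confine a point under a list of
   words. *)
pose task : Type := ((seq nat * seq nat) + (seq (seq (K * bool)) * nat))%type.
pose R (i : nat) (G : stage K) : Prop := match unpickle i : option task with
  | Some (inl (s, s')) => size s = size s' -> uniq s -> uniq s' ->
      exists g, forall j, j < size s ->
        [/\ nth 0 s j < bound G, savoids G g (nth 0 s j)
          & wact (sact G) g (nth 0 s j) = nth 0 s' j]
  | Some (inr (ws, s)) => loops_off_edge ws ->
      exists2 C, C s & closed_under G ws C
  | None => True end.
have dense i G : exists2 H, extends G H & R i H.
  rewrite /R; case: unpickle => [[[s s']|[ws s]]|].
  - case: (pselect [/\ size s = size s', uniq s & uniq s']) => [[h1 h2 h3]|h].
      by have [H GH hH] := extension_moving other_letter G h1 h2 h3; exists H.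
    have [H GH _] := extension_large other_letter G 0; exists H => // h1 h2 h3.
    by case: h.
  - case: (pselect (loops_off_edge ws)) => h; last first.
      by have [H GH _] := extension_large other_letter G 0; exists H => // /h.
    have [H GH sH] := extension_large other_letter G s.+1.
    have [I HI hI] := extension_closing other_letter H h.
    by exists I; [apply: extends_trans HI|move=> _; apply: hI].
  - by have [H GH _] := extension_large other_letter G 0; exists H.
have [G0 _] := initial_stage z0.
have [m mP hm] := limit_action G0 dense.
exists nat, (free_action mP); split.
- exact: infinite_nat.
- move=> k _ s s' s_inj s'_inj.
  pose q := [seq s i | i <- enum 'I_k]; pose q' := [seq s' i | i <- enum 'I_k].
  have [H] := hm (pickle (inl (q, q') : task)).
  rewrite /R pickleK => hR mH.
  have qq' : size q = size q' by rewrite !size_map.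
  have uq : uniq q by rewrite map_inj_uniq // enum_uniq.
  have uq' : uniq q' by rewrite map_inj_uniq // enum_uniq.
  have [g hg] := hR qq' uq uq'.
  exists (ev g) => j; rewrite /= free_actE //.
  have jk : (j < size (enum 'I_k))%N by rewrite size_enum_ord.
  have [] := hg j; first by rewrite size_map.
  have -> : nth 0 q j = s j by rewrite /q (nth_map j) ?nth_ord_enum.
  have -> : nth 0 q' j = s' j by rewrite /q' (nth_map j) ?nth_ord_enum.
  move=> h1 h2 <-.
  exact: mH.
- move=> L Lsub [A Afin LA] Linf s.
  have [sA AE] := (finite_seqP A).1 Afin.
  have /choice[wd wdE] := ev_surj.
  (* With the inverses included, [C] is invariant under the whole subgroup generated. *)
  pose ws := [seq wd g | g <- sA] ++ [seq winv (wd g) | g <- sA].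
  have AL g : g \in sA -> L g.
    by move=> gA; rewrite LA => B [_ AB]; apply: AB; rewrite AE.
  have Lws w : w \in ws -> L (ev w).
    rewrite mem_cat => /orP[] /mapP[g gA ->]; rewrite ?ev_inv wdE; first exact: AL.
    by case: Lsub => _ _; apply; apply: AL.
  have [H] := hm (pickle (inr (ws, s) : task)).
  rewrite /R pickleK => /(_ (infinite_index_loops Lsub Linf Lws))[C Cs clC] mH.
  have Cw w v : w \in ws -> C v -> C (free_action mP (ev w) v).
    move=> hw Cv; have [vH /(_ w hw)[aw Cwv]] := clC v Cv.
    by rewrite /= free_actE // mH.
  pose Z : set F := [set g | forall v, C v ->
    C (free_action mP g v) /\ C (free_action mP (g^-1)%g v)].
  have LZ g : L g -> Z g.
    rewrite LA; apply; split; first split.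
    + by move=> v Cv; rewrite invg1 !act1.
    + move=> x y Zx Zy v Cv; rewrite invgM !actM.
      by split; [case: (Zx _ (Zy v Cv).1)|case: (Zy _ (Zx v Cv).2)].
    + by move=> x Zx v Cv; rewrite invgK; case: (Zx v Cv).
    + move=> x; rewrite AE /= => xA v Cv; split.
        rewrite -(wdE x); apply: Cw => //.
        by rewrite mem_cat map_f.
      rewrite -(wdE x) -ev_inv; apply: Cw => //.
      by rewrite mem_cat (map_f (fun g => winv (wd g))) ?orbT.
  apply: (sub_finite_set _ (finite_II (bound H))) => _ [g Lg <-] /=.
  by case: (clC _ (LZ g Lg s Cs).1).
Qed.

End FreeGroup.

(** * Faithfulness *)

Section Cycle.
Variable K : eqType.

(** Cyclic reducedness means that two edges of the cycle with the same letter share neither source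
    nor target, so each letter is a partial injection. *)
Lemma cyclic_word_action n (W : 'I_n.+1 -> K * bool) :
  (forall i, W (ordS i) <> linv (W i)) ->
  exists2 m : K * bool -> 'I_n.+1 -> 'I_n.+1, letter_action m &
    forall i, m (W i) (ordS i) = i.
Proof.
move=> Wred.
pose h y (u : 'I_n.+1) := if W (ord_pred u) == (y, false) then Some (ord_pred u)
  else if W u == (y, true) then Some (ordS u) else None.
have hE y u c : h y u = Some c ->
    c = ord_pred u /\ W c = (y, false) \/ c = ordS u /\ W u = (y, true).
  by rewrite /h; case: eqP => [E [<-]|_]; [left|case: eqP => // E [<-]; right].
have [y u v c|m mP hm] := @letter_action_completion K _ h.
  case/hE=> -[-> Wu] /hE[] [E Wv].
  - exact: ord_pred_inj E.
  - by have := Wred v; rewrite -E Wu Wv.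
  - by have := Wred u; rewrite Wu Wv.
  - exact: ordS_inj E.
exists m => // i; case E: (W i) => [y []].
  have /hm mi : h y i = Some (ordS i).
    rewrite /h E eqxx; case: eqP => // E'; have := Wred (ord_pred i).
    by rewrite ord_predK E E'.
  by rewrite -mi; apply: (mP (y, false)).
by apply: hm; rewrite /h ordSK E eqxx.
Qed.

End Cycle.

Section Faithful.
Variables (F : groupType) (K : finType) (ev : seq (K * bool) -> F).
Hypothesis ev_cat : forall w w', ev (w ++ w') = (ev w * ev w')%g.
Hypothesis ev_inv : forall w, ev (winv w) = (ev w)^-1%g.
Hypothesis ev_surj : forall g, exists w, ev w = g.
Hypothesis ev_free : forall (T : Type) (m : K * bool -> T -> T), letter_action m ->
  forall w w', ev w = ev w' -> forall v, wact m w v = wact m w' v.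

Let ev0 : ev [::] = 1%g := ev_nil ev_cat.

(** In a shortest word a cyclic cancellation could be rotated to the front and deleted, leaving a
    shorter nontrivial conjugate in [N]. *)
Lemma minimal_word_in_normal (N : set F) :
  (forall g h, N g -> N (h * g * h^-1)%g) -> (exists2 g, N g & g <> 1%g) ->
  exists n (W : nat -> K * bool), N (ev (mkseq W n.+1)) /\
    forall i, i <= n -> W (i.+1 %% n.+1) <> linv (W i).
Proof.
move=> NJ [g Ng g1]; pose P w := N (ev w) /\ ev w <> 1%g.
have exP : exists k, `[< exists2 w, P w & size w = k >].
  by have [w wE] := ev_surj g; exists (size w); apply/asboolP; exists w; rewrite // /P wE.
case: (ex_minnP exP) => k /asboolP[w Pw wk] k_min.
have {exP k_min} w_min w' : P w' -> size w <= size w'.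
  by move=> Pw'; rewrite wk; apply: k_min; apply/asboolP; exists w'.
case: w Pw w_min {wk} => [[_]|l w]; first by rewrite ev0.
set w0 := l :: w => Pw w_min; pose n := size w; pose W := nth l w0.
exists n, W; rewrite [mkseq _ _]mkseq_nth; split=> [|i i_n E]; first by case: Pw.
have Prot : P (rot i w0).
  case: Pw; rewrite -{1 2}(cat_take_drop i w0) /P /rot !ev_cat => Nw w1; split.
    have := NJ _ (ev (take i w0))^-1%g Nw.
    by rewrite invgK mulKg.
  by move=> w1'; apply: w1; rewrite -[LHS](mulgK (ev (take i w0))) -[X in (X / _)%g]mulgA w1' mulg1 mulgV.
have [w' rotE] : exists w', rot i w0 = W i :: linv (W i) :: w'.
  have i_w0 : i < size w0 by [].
  rewrite /rot (drop_nth l i_w0) -/W -E.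
  (* At [i = n] the next letter is the first one; here [n > 0], as no letter is its own inverse. *)
  move: i_n; rewrite leq_eqVlt => /predU1P[iE|i_n]; last first.
    rewrite modn_small // (drop_nth l) -/W; last by rewrite /= ltnS.
    by exists (drop i.+2 w0 ++ take i w0).
  have i_gt0 : 0 < i.
    by case: i iE E {Prot i_w0} => // iE; rewrite -iE modn1 /W /=; case: (l) => ? [].
  move: E i_w0; rewrite iE modnn => E _; rewrite drop_oversize //.
  have n_gt0 : 0 < n by rewrite -iE.
  by exists (take n.-1 w); rewrite -(prednK n_gt0).
have sE : size w0 = (size w').+2 by rewrite -(size_rot i w0) rotE.
have Pw' : P w'.
  move: Prot; rewrite rotE /P -[_ :: _ :: _]/([:: W i] ++ winv [:: W i] ++ w').
  by rewrite !ev_cat ev_inv mulVKg.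
by have := w_min _ Pw'; rewrite sE ltnNge leqnSn.
Qed.

(** * Paths of a finite action that avoid one edge *)

Section OffEdge.
Variables (T : finType) (m : K * bool -> T -> T) (t : T) (l0 : K * bool).
Hypothesis mP : letter_action m.

(** At [v = t] this is the subgroup M; at any other [v] it lies in a single left coset of M. *)
Definition off_edge_paths v : set F :=
  [set g | exists u, [/\ wact m u t = v, avoids m t l0 u t & ev u = g]].

Lemma off_edge_subgroup : is_subgroup (off_edge_paths t).
Proof.
split.
- by exists [::]; rewrite ev0.
- move=> _ _ [u [uE au <-]] [v [vE av <-]]; exists (u ++ v).
  by rewrite wact_cat vE uE ev_cat; split=> //; apply/avoids_cat; rewrite vE.
- move=> _ [u [uE au <-]]; exists (winv u); rewrite ev_inv; split=> //.
    by have := wactV mP u t; rewrite uE.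
  by have := avoidsV mP au; rewrite uE.
Qed.

Lemma off_edge_paths_coset v : exists p : F, forall g, off_edge_paths v g ->
  off_edge_paths t (p^-1 * g)%g.
Proof.
case: (pselect (exists p, off_edge_paths v p)) => [[_ [p [pE ap _]]]|h]; last first.
  by exists 1%g => g hg; case: h; exists g.
exists (ev p) => _ [u [uE au <-]]; exists (winv p ++ u).
rewrite wact_cat uE ev_cat ev_inv; split=> //.
  by have := wactV mP p t; rewrite pE.
by apply/avoids_cat; split=> //; rewrite uE; have := avoidsV mP ap; rewrite pE.
Qed.

(* Schreier generators, for a choice of one path [p v] to each vertex [v]. *)
Lemma off_edge_fg : finitely_generated (off_edge_paths t).
Proof.
have /choice[p hp] v : exists p, (v = t -> p = [::]) /\
    ((exists g, off_edge_paths v g) -> wact m p t = v /\ avoids m t l0 p t).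
  have [->|/eqP vt] := eqVneq v t; first by exists [::].
  case: (pselect (exists g, off_edge_paths v g)) => [[_ [p [pE ap _]]]|h].
    by exists p.
  by exists [::].
have path_p u : avoids m t l0 u t ->
    wact m (p (wact m u t)) t = wact m u t /\ avoids m t l0 (p (wact m u t)) t.
  by move=> au; apply: (hp _).2; exists (ev u), u.
pose gen (x : T * (K * bool)) := ev (winv (p (m x.2 x.1)) ++ x.2 :: p x.1).
pose I : set (T * (K * bool)) := [set x | (exists g, off_edge_paths x.1 g) /\
  ~ crosses m t l0 x.2 x.1].
exists (gen @` I).
  apply/finite_image/(sub_finite_set _ (finite_seq (enum {: T * (K * bool)}))).
  by move=> x _; rewrite /= mem_enum.
apply/seteqP; split=> g.
  move=> [u [ut au <-]] B [[B1 BM BV] IB].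
  (* Telescoping: each letter contributes one generator, and [p t] is empty, so a loop yields [ev u]
     itself. *)
  suff H : B ((ev (p (wact m u t)))^-1 * ev u)%g.
    by move: H; rewrite ut (hp t).1 // ev0 invg1 mul1g.
  elim: u au {ut} => [|l u IH] /=; first by rewrite (hp t).1 // mulVg.
  move=> [au nc]; set v := wact m u t in nc *.
  have genI : B (gen (v, l)) by apply: IB; exists (v, l) => //; split=> //; exists (ev u), u.
  have := BM _ _ genI (IH au); rewrite /gen /= !ev_cat ev_inv.
  rewrite -/v -[l :: p v]cat1s -[l :: u]cat1s !ev_cat.
  by rewrite -!mulgA mulVKg.
apply; split; first exact: off_edge_subgroup.
move=> _ [[v l] [[h [u [uE au _]]] nc] <-]; rewrite /gen /= in uE nc *.
have [pE ap] := path_p _ au; rewrite uE in pE ap.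
have al : avoids m t l0 (l :: p v) t by rewrite /= pE.
have [] := path_p _ al; rewrite /= pE => qE aq.
exists (winv (p (m l v)) ++ l :: p v); rewrite wact_cat /= pE; split=> //.
  by have := wactV mP (p (m l v)) t; rewrite qE.
apply/avoids_cat; split=> //=; rewrite pE.
by have := avoidsV mP aq; rewrite qE.
Qed.

Section Wrapping.
Variable r : seq (K * bool).
Hypotheses (rE : wact m r (m l0 t) = t) (ar : avoids m t l0 r (m l0 t)).

(* Counting signed crossings of the edge gives an action on [T * int] in which the
   loop [rcons r l0] translates while all paths off the edge keep the second
   coordinate. *)
Lemma off_edge_infinite_index : infinite_index (off_edge_paths t).
Proof.
pose delta l v : int := if (l == l0) && (v == t) then 1%R
  else if (l == linv l0) && (v == m l0 t) then (-1)%R else 0%R.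
pose mz l (x : T * int) := (m l x.1, (x.2 + delta l x.1)%R).
have l0V : l0 == linv l0 = false by case: (l0) => x []; apply/eqP.
have deltaV l v : delta (linv l) (m l v) = (- delta l v)%R.
  rewrite /delta; have [->|n1] := eqVneq l l0.
    rewrite [linv l0 == l0]eq_sym l0V eqxx /= (inj_eq (letter_action_inj mP (l := l0))).
    by case: eqP.
  have [lE|n2] := eqVneq l (linv l0).
    rewrite lE linvK eqxx l0V /= -{1}(mP l0 t).
    by rewrite (inj_eq (letter_action_inj mP (l := linv l0))); case: eqP.
  rewrite (can_eq (@linvK K)) (negPf n1) ifN //.
  by apply: contra n2 => /andP[/eqP <-]; rewrite linvK.
have mzP : letter_action mz.
  by move=> l [v k]; rewrite /mz /= mP deltaV GRing.addrK.
have mz_off u v k : avoids m t l0 u v -> wact mz u (v, k) = (wact m u v, k).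
  elim: u => //= l u IH [/IH-> nc]; rewrite /mz /=; congr pair.
  rewrite /delta; case: ifP => [/andP[/eqP lE /eqP vE]|_]; first by case: nc; left.
  case: ifP => [/andP[/eqP lE /eqP vE]|_]; first by case: nc; right.
  by rewrite GRing.addr0.
pose a := free_action ev_cat ev_surj ev_free mzP.
have aE w x : a (ev w) x = wact mz w x by exact: free_actE.
have aw k : a (ev (r ++ [:: l0])) (t, k) = (t, k + 1)%R.
  rewrite aE wact_cat /= {2}/mz /= /delta !eqxx /= mz_off //.
  by rewrite rE.
have aM g x : off_edge_paths t g -> a (x * g)%g (t, 0%R) = a x (t, 0%R).
  by move=> [u [uE au <-]]; rewrite actM [X in a x X]aE mz_off // uE.
move=> fin.
(* By [aM] the crossing number does not depend on the representative; the power [k] of the loop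
   gives the value [k]. *)
pose psi (c : set F) := absz (a (xget 1%g c) (t, 0%R)).2.
have := finite_image psi fin; apply: (sub_infinite_set _ infinite_nat) => k _ /=.
pose g := (ev (r ++ [:: l0]) ^+ k)%g.
exists (left_coset g (off_edge_paths t)); first by exists g.
rewrite /psi; have [x hx <-] : left_coset g (off_edge_paths t)
    (xget 1%g (left_coset g (off_edge_paths t))).
  apply: xgetPex; exists g; exists 1%g; last by rewrite mulg1.
  by case: off_edge_subgroup.
rewrite aM // /g; suff -> : a (ev (r ++ [:: l0]) ^+ k)%g (t, 0%R) = (t, Posz k) by [].
elim: (k) => [|j IH]; first by rewrite expg0 act1.
by rewrite expgS actM IH aw; congr pair; lia.
Qed.

(* Modulo a normal subgroup containing the loop, the edge can be replaced by [winv r]. *)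
Lemma off_edge_cover (N : set F) g : is_subgroup N ->
  (forall g h, N g -> N (h * g * h^-1)%g) -> N (ev (r ++ [:: l0])) ->
  exists v h, off_edge_paths v h /\ N (h^-1 * g)%g.
Proof.
move=> [N1 NM NV] NJ Nw; have [w <-] := ev_surj g.
have NJ' x y : N x -> N (y^-1 * x * y)%g by move=> /(NJ x (y^-1)%g); rewrite invgK.
suff [u [au Nu]] : exists u, avoids m t l0 u t /\ N ((ev u)^-1 * ev w)%g.
  by exists (wact m u t), (ev u); split=> //; exists u.
elim: w => [|l w [u [au Nu]]]; first by exists [::]; rewrite mulVg.
pose g0 := ev [:: l0]; have Nw' : N (ev r * g0)%g by rewrite -ev_cat.
have linvE : ev [:: linv l0] = (g0^-1)%g.
  by rewrite /g0 -ev_inv.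
rewrite -[l :: w]cat1s ev_cat.
case: (pselect (crosses m t l0 l (wact m u t))) => [[[lE uE]|[lE uE]]|nc].
- exists (winv r ++ u); split.
    by apply/avoids_cat; rewrite uE; split=> //; have := avoidsV mP ar; rewrite rE.
  rewrite lE -/g0 ev_cat ev_inv invgM invgK.
  have -> : ((ev u)^-1 * ev r * (g0 * ev w))%g =
    ((ev u)^-1 * (ev r * g0) * ev u * ((ev u)^-1 * ev w))%g by rewrite -!mulgA mulVKg.
  by apply: NM => //; apply: NJ'.
- exists (r ++ u); split; first by apply/avoids_cat; rewrite uE.
  rewrite lE linvE ev_cat invgM.
  have -> : ((ev u)^-1 * (ev r)^-1 * (g0^-1 * ev w))%g =
    ((ev u)^-1 * ((g0 * ev r)^-1) * ev u * ((ev u)^-1 * ev w))%g.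
    by rewrite invgM -!mulgA mulVKg.
  apply: NM => //; apply: (NJ'); apply: NV.
  have -> : (g0 * ev r = (ev r)^-1 * (ev r * g0) * ev r)%g by rewrite -!mulgA mulKg.
  exact: NJ'.
- exists (l :: u); split=> //.
  by rewrite -[l :: u]cat1s ev_cat invgM -mulgA mulKg.
Qed.

End Wrapping.
End OffEdge.

Lemma locally_finite_faithful (S : Type) (a : group_action F S) :
  infinite_set [set: S] -> k_transitive a 1 ->
  (forall L : set F, is_subgroup L -> finitely_generated L ->
     infinite_index L -> locally_finite_on a L) ->
  faithful_action a.
Proof.
move=> Sinf tr lf; pose N := action_kernel a.
have N_sub : is_subgroup N.
  split=> [s|x y Nx Ny s|x Nx s]; first exact: act1.
    by rewrite actM Ny.
  by rewrite -[in LHS](Nx s) -actM mulVg act1.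
have NJ g h : N g -> N (h * g * h^-1)%g.
  by move=> Ng s; rewrite !actM Ng -actM mulgV act1.
apply: contrapT => nf.
have [g Ng g1] : exists2 g, N g & g <> 1%g.
  apply: contrapT => h; apply: nf; apply/seteqP; split=> g /=; last first.
    by move=> ->; case: N_sub.
  by move=> Ng; apply: contrapT => g1; apply: h; exists g.
have [n [W [NW Wn]]] := minimal_word_in_normal NJ (ex_intro2 _ _ g Ng g1).
have Wred (i : 'I_n.+1) : W (ordS i) <> linv (W i) by apply: Wn; rewrite -ltnS.
have [m mP mW] := cyclic_word_action Wred.
(* The chosen edge closes the cycle from [0] to [n]; the other letters lead from [n] back down to
   [0]. *)
pose t : 'I_n.+1 := ord0; pose l0 := W n.
have start : m l0 t = inord n.
  have -> : t = ordS (inord n) by apply: val_inj; rewrite /= inordK // modnn.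
  by rewrite -[RHS]mW inordK.
have run j : j <= n -> let r := [seq W i | i <- iota (n - j) j] in
    wact m r (m l0 t) = inord (n - j) /\ avoids m t l0 r (m l0 t).
  elim: j => [|j IH] jn /=; first by rewrite subn0 start.
  set k := n - j.+1; have kE : n - j = k.+1 by rewrite /k; lia.
  have [] := IH (ltnW jn); rewrite kE => -> ar.
  have kn : k < n by rewrite /k; lia.
  have <- : ordS (inord k) = inord k.+1 :> 'I_n.+1.
    by apply: val_inj; rewrite /= !inordK ?modn_small //; lia.
  have Wk : W (inord k : 'I_n.+1) = W k by rewrite inordK //; lia.
  rewrite -{1}Wk mW; split=> //; split=> //.
  (* Crossing forwards would start at [0], not at [k.+1]; crossing backwards would force [k.+1 = n]
     and make [W k] inverse to [W n]. *)
  move=> [[_ /(congr1 val)]|[WE]] /=.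
    by rewrite inordK ?modn_small //; lia.
  rewrite start => /(congr1 val) /=; rewrite !inordK ?modn_small //; [|lia..].
  move=> knE; case: (Wred (inord k)).
  by rewrite /= inordK ?modn_small ?knE -/l0 ?WE ?linvK //; lia.
pose r := mkseq W n.
have rE : mkseq W n.+1 = r ++ [:: l0].
  by rewrite /mkseq -addn1 iotaD map_cat.
have [r1 ar] : wact m r (m l0 t) = t /\ avoids m t l0 r (m l0 t).
  have := run n (leqnn n); rewrite /= subnn => -[-> ?]; split=> //.
  by apply: val_inj; rewrite /= inordK.
rewrite rE in NW.
have M_sub := off_edge_subgroup t l0 mP.
have M_fg := off_edge_fg t l0 mP.
have M_inf := off_edge_infinite_index mP r1 ar.
have M_lf := lf _ M_sub M_fg M_inf.
have /choice[p hp] := off_edge_paths_coset t l0 mP.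
have [s _] := infinite_setN0 Sinf.
apply: Sinf.
(* By transitivity and the cover, [S] is a finite union of translates by [p v] of the finite M-orbit
   of [s]. *)
apply: (sub_finite_set (B := \bigcup_(v in [set: 'I_n.+1])
  (a (p v) @` orbit_under a (off_edge_paths m t l0 t) s))); last first.
  apply: bigcup_finite => [|v _]; last exact/finite_image/M_lf.
  apply: (sub_finite_set _ (finite_seq (enum 'I_n.+1))) => v _ /=.
  by rewrite mem_enum.
move=> s' _.
have [||g' gE] := tr (fun=> s) (fun=> s'); [by move=> i j _; rewrite !ord1|
  by move=> i j _; rewrite !ord1|].
have [v [h [hv Nh]]] := off_edge_cover mP r1 ar g' N_sub NJ NW.
exists v => //; exists (a ((p v)^-1 * h)%g s).
  by exists ((p v)^-1 * h)%g => //; apply: hp.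
rewrite -(gE ord0) -actM mulVKg -{1}(Nh s) -actM mulVKg //.
Qed.

End Faithful.

(** * Free bases *)

Section FreeBasis.
Variable F : groupType.
Implicit Types (X : set F) (w : seq (F * bool)).

Lemma word_value_cons (l : F * bool) w :
  word_value (l :: w) = ((if l.2 then l.1^-1 else l.1) * word_value w)%g.
Proof. exact: big_cons. Qed.

Lemma word_value_cat w w' : word_value (w ++ w') = (word_value w * word_value w')%g.
Proof. exact: big_cat. Qed.

Lemma word_value_inv w : word_value (winv w) = ((word_value w)^-1)%g.
Proof.
elim: w => [|[x e] w IH]; first by rewrite /word_value !big_nil invg1.
rewrite winv_cons -cats1 word_value_cat IH !word_value_cons invgM /=.
by rewrite /word_value big_nil mulg1; case: e; rewrite ?invgK.
Qed.

Definition push (l : F * bool) w :=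
  if w is l' :: w' then (if l' == linv l then w' else l :: w) else [:: l].

Lemma reduced_push l w : reduced w -> reduced (push l w).
Proof.
case: w => //= l' w; case: eqP => [_|ll'] /=; first exact: path_sorted.
rewrite /reduced /= => ->; rewrite andbT; apply/negP => /andP[/eqP e1 e2].
apply: ll'; case: l l' e1 e2 => x e [x' e'] /= -> ne.
by rewrite /linv /=; case: e e' ne => [] [].
Qed.

Lemma word_value_push l w : word_value (push l w) = word_value (l :: w).
Proof.
case: w => //= l' w; case: eqP => // ->; rewrite !word_value_cons mulgA.
by case: l => x [] /=; rewrite ?mulgV ?mulVg mul1g.
Qed.

Lemma wact_push T (m : F * bool -> T -> T) l w v : letter_action m ->
  wact m (push l w) v = wact m (l :: w) v.
Proof. by move=> mP; case: w => //= l' w; case: eqP => // ->; rewrite letter_actionV. Qed.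

Lemma word_over_push X l w : word_over X (l :: w) -> word_over X (push l w).
Proof.
case: w => //= l' w Xw; case: ifP => // _ k kw.
by apply: Xw; rewrite !inE kw !orbT.
Qed.

(** Free reduction preserves both value and action, and reduced words over a basis are determined by
    their value. *)
Lemma free_basis_wact X T (m : F * bool -> T -> T) w w' v :
  free_basis X -> letter_action m -> word_over X w -> word_over X w' ->
  word_value w = word_value w' -> wact m w v = wact m w' v.
Proof.
move=> XB mP Xw Xw' ww'.
have red u : word_over X u -> exists u', [/\ word_over X u', reduced u',
    word_value u' = word_value u & wact m u' v = wact m u v].
  elim: u => [|l u IH] Xu; first by exists [::].
  have [k ku|u' [Xu' ru' vu' au']] := IH; first by apply: Xu; rewrite inE ku orbT.
  exists (push l u'); split.
  - apply: word_over_push => k; rewrite inE => /predU1P[->|/Xu'//].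
    by apply: Xu; rewrite mem_head.
  - exact: reduced_push.
  - by rewrite word_value_push !word_value_cons vu'.
  - by rewrite wact_push //= au'.
have [u [Xu ru uE <-]] := red w Xw; have [u' [Xu' ru' u'E <-]] := red w' Xw'.
have [x [_ xU]] := XB (word_value w); congr wact.
have <- : x = u by apply: xU.
by apply: xU; rewrite u'E.
Qed.

(** The letters in words for finitely many generators exhaust the basis: a further [x] would equal a
    word without [x], which the parity of [x] rules out. *)
Lemma free_basis_finite X : free_basis X -> finitely_generated [set: F] ->
  exists s : seq F, X = [set` s].
Proof.
move=> XB [A /finite_seqP[sA ->] FA].
have /choice[wd hwd] g : exists w, word_over X w /\ word_value w = g.
  by have [w [[Xw _ wE] _]] := XB g; exists w.
pose s := [seq l.1 | l <- flatten [seq wd g | g <- sA]].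
have sX x : x \in s -> X x.
  by case/mapP=> l /flattenP[w /mapP[g _ ->] lw] ->; apply: (hwd g).1 lw.
exists s; apply/seteqP; split=> x /=; last exact: sX.
move=> Xx; apply/negPn/negP => xs.
have [w ws wx] : exists2 w, word_over [set` s] w & word_value w = x.
  have gx : generated [set` sA] x by rewrite -FA.
  apply: (gx [set g | exists2 w, word_over [set` s] w & word_value w = g]).
  split; first split.
  - by exists [::]; rewrite // /word_value big_nil.
  - move=> _ _ [w ws <-] [w' ws' <-]; exists (w ++ w'); last exact: word_value_cat.
    by move=> l; rewrite mem_cat => /orP[/ws|/ws'].
  - move=> _ [w ws <-]; exists (winv w); last exact: word_value_inv.
    by move=> l; rewrite mem_rev => /mapP[k /ws ? ->].
  - move=> g gA; exists (wd g); last exact: (hwd g).2.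
    move=> l lg; apply/mapP; exists l => //; apply/flattenP; exists (wd g) => //.
    exact: map_f.
pose m (l : F * bool) b := if l.1 == x then ~~ b else b.
have mP : letter_action m by move=> l b; rewrite /m /=; case: eqP; rewrite ?negbK.
have wX : word_over X w by move=> l /ws /sX.
have xX : word_over X [:: (x, false)] by move=> l; rewrite inE => /eqP ->.
have := free_basis_wact true XB mP wX xX.
rewrite wx /word_value big_seq1 => /(_ erefl) /=; rewrite /m /= eqxx.
suff -> : wact m w true = true by [].
elim: w ws {wx wX} => //= l w IH ws; rewrite IH => [|k kw]; last first.
  by apply: ws; rewrite inE kw orbT.
rewrite /m; case: eqP => // lx; case/negP: xs; rewrite -lx.
by apply: ws; rewrite mem_head.
Qed.

End FreeBasis.

Section FiniteBasis.
Variables (F : groupType) (s : seq F).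
Hypothesis sB : free_basis [set` s].

Definition emb (l : seq_sub s * bool) : F * bool := (val l.1, l.2).

Definition eval_word (w : seq (seq_sub s * bool)) := word_value (map emb w).

Lemma word_over_emb w : word_over [set` s] (map emb w).
Proof. by move=> l /mapP[k _ ->] /=; apply: ssvalP. Qed.

Lemma eval_word_cat w w' : eval_word (w ++ w') = (eval_word w * eval_word w')%g.
Proof. by rewrite /eval_word map_cat word_value_cat. Qed.

Lemma eval_word_inv w : eval_word (winv w) = ((eval_word w)^-1)%g.
Proof.
by rewrite /eval_word -word_value_inv /winv map_rev -!map_comp.
Qed.

Lemma eval_word_surj g : exists w, eval_word w = g.
Proof.
have [w [[ws _ <-] _]] := sB g.
suff [w' w'E] : exists w', map emb w' = w by exists w'; rewrite /eval_word w'E.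
elim: w ws => [|[x e] w IH] ws; first by exists [::].
have [k kw|w' <-] := IH; first by apply: ws; rewrite inE kw orbT.
have xs : x \in s by apply: (ws (x, e)); rewrite mem_head.
by exists ((SeqSub xs, e) :: w').
Qed.

Lemma eval_word_free (T : Type) (m : seq_sub s * bool -> T -> T) :
  letter_action m -> forall w w', eval_word w = eval_word w' ->
  forall v, wact m w v = wact m w' v.
Proof.
move=> mP w w' ww' v.
(* Elements outside [s] act trivially. *)
pose m' (l : F * bool) v := if insub l.1 is Some k then m (k, l.2) v else v.
have m'P : letter_action m'.
  move=> [x e] u; rewrite /m' /=; case: insubP => [k _ _|/negPf xs] //=.
  exact: (mP (k, e)).
have m'E u : wact m' (map emb u) v = wact m u v.
  by elim: u => //= -[k e] u ->; rewrite /m' /= valK.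
rewrite -!m'E; apply: free_basis_wact sB m'P _ _ ww'; exact: word_over_emb.
Qed.

Lemma cyclic_of_one_generator c : (forall x, x \in s -> x = c) ->
  is_cyclic [set: F].
Proof.
move=> sc; exists c; apply/seteqP; split=> // g _ B [[B1 BM BV] cB].
have [w <-] := eval_word_surj g; rewrite /eval_word.
elim: w => [|[k e] w IH]; first by rewrite /word_value big_nil.
rewrite /= word_value_cons; apply: BM => //=; rewrite (sc _ (ssvalP k)).
by case: e; [apply: BV|]; apply: cB.
Qed.

(** This is where noncyclicity enters: the rank is at least two. *)
Lemma other_generator : ~ is_cyclic [set: F] ->
  forall z : seq_sub s, exists a, a <> z.
Proof.
move=> nc z; apply: contrapT => /forallNP h; apply: nc.
apply: (@cyclic_of_one_generator (val z)) => x xs.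
by have /contrapT/(congr1 val) := h (SeqSub xs).
Qed.

End FiniteBasis.

Theorem corollary1p2 (F : groupType)
    (F_free : free_group F)
    (F_fg : finitely_generated [set: F])
    (F_noncyclic : ~ is_cyclic [set: F]) :
  (exists (S : Type) (a : group_action F S),
      [/\ infinite_set [set: S],
          highly_transitive a
        & forall L : set F, is_subgroup L -> finitely_generated L ->
            infinite_index L -> locally_finite_on a L])
  /\
  (forall (S : Type) (a : group_action F S),
      infinite_set [set: S] ->
      highly_transitive a ->
      (forall L : set F, is_subgroup L -> finitely_generated L ->
         infinite_index L -> locally_finite_on a L) ->
      faithful_action a).
Proof.
have [X XB] := F_free; have [s XE] := free_basis_finite XB F_fg; rewrite XE in XB.
have ev_cat := @eval_word_cat F s; have ev_inv := @eval_word_inv F s.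
have ev_surj := eval_word_surj XB; have ev_free := eval_word_free XB.
split=> [|S a Sinf ht lf]; last first.
  exact: (locally_finite_faithful ev_cat ev_inv ev_surj ev_free Sinf (ht 1 isT) lf).
(* An empty basis would make the group trivial, generated by [1]. *)
have [z0 _] : exists z0 : seq_sub s, True.
  apply: contrapT => h; apply: F_noncyclic.
  by apply: (cyclic_of_one_generator XB (c := 1%g)) => x xs; case: h; exists (SeqSub xs).
exact: (exists_highly_transitive_locally_finite ev_cat ev_inv ev_surj ev_free
  (other_generator XB F_noncyclic) z0).
Qed.
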